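(* Suppose that the sequences $a_k$ and $b_k$ are nondecreasing and that for some integers $1\le j<k$ the following hold. (i) $T_4(\mathbf{p}_j)\ge0$ for all $x\ge\max\{x_{j+1,j+1},\,b_{j+1}+a_{j+1}\}$. (ii) For $t\ge0$ the following quadratics are nonnegative: $$\mathcal{P}_i(t)=a_{i-1}A_i+B_it+a_{i-1}C_it^2,\qquad i=j+1,\dots,k,$$ where $$A_i=3a_{i+1}a_{i+2}-4a_ia_{i+2}+a_{i-1}a_i,$$ $$B_i=a_{i-1}(4a_{i+2}-a_{i-1})(b_i-b_{i-1})-a_i^2(b_{i+1}-b_{i-2}),$$ $$C_i=(a_i-a_{i-1}+b_i-b_{i-1})(b_{i+1}-b_{i-2})+(a_i-a_{i-1})(4a_{i+2}-a_{i-1})-a_{i+1}(a_{i+1}-a_{i-2}).$$ (iii) For $i=j,\dots,k-1$, $\ a_i\ge b_{i+1}-b_i$. Then $T_4(\mathbf{p}_k)\ge0$ for all $x>\max\{x_{k,k},\,b_k+a_k\}$.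
   Context: $\mathbf{p}_k$ are the orthonormal polynomials defined by $\mathbf{p}_{-1}=0$, $\mathbf{p}_0=1$ and $a_k\mathbf{p}_k=(x-b_{k-1})\mathbf{p}_{k-1}-a_{k-1}\mathbf{p}_{k-2}$, $k\ge1$, where $b_k\in\mathbb{R}$, $a_k>0$ for $k\ge1$, and $a_0=0$. $x_{k,k}$ denotes the largest zero of $\mathbf{p}_k$, and $$T_4(\mathbf{p}_k)=3\mathbf{p}_k^2-4\mathbf{p}_{k-1}\mathbf{p}_{k+1}+\mathbf{p}_{k-2}\mathbf{p}_{k+2}.$$ *)

(* Defs.v *)
From HB Require Import structures.
From mathcomp Require Export all_boot all_order all_algebra.
From mathcomp Require Export reals.
From mathcomp Require Import boolp polyrcf.

Set Implicit Arguments.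
Unset Strict Implicit.
Unset Printing Implicit Defensive.

Import Order.TTheory GRing.Theory Num.Theory.
Local Open Scope ring_scope.

Section OrthonormalPolynomials.
Variables (R : realType) (a b : nat -> R).

(* The index is shifted by one so that it can start at -1:
   [shifted_opoly n] is p_{n-1}. *)
Fixpoint shifted_opoly (n : nat) : {poly R} :=
  match n with
  | 0 => 0
  | 1 => 1
  | (k.+1 as n').+1 =>
      (a k.+1)^-1 *: (('X - (b k)%:P) * shifted_opoly n' - a k *: shifted_opoly k)
  end.

Definition opoly (k : nat) : {poly R} := shifted_opoly k.+1.

Lemma opoly_rec (k : nat) : (1 <= k)%N -> 0 < a k ->
  a k *: opoly k = ('X - (b k.-1)%:P) * opoly k.-1 - a k.-1 *: shifted_opoly k.-1.
Proof.
by case: k => // k _ ak; rewrite /opoly /= scalerA divff ?gt_eqF // scale1r.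
Qed.

(* 3 p_k^2 - 4 p_{k-1} p_{k+1} + p_{k-2} p_{k+2}, meaningful for k >= 1 only. *)
Definition T4 (k : nat) : {poly R} :=
  3 *: opoly k ^+ 2 - 4 *: (opoly k.-1 * opoly k.+1) + shifted_opoly k.-1 * opoly k.+2.

Definition coefA (i : nat) : R :=
  3 * a i.+1 * a i.+2 - 4 * a i * a i.+2 + a i.-1 * a i.

Definition coefB (i : nat) : R :=
  a i.-1 * (4 * a i.+2 - a i.-1) * (b i - b i.-1)
  - a i ^+ 2 * (b i.+1 - b i.-2).

Definition coefC (i : nat) : R :=
  (a i - a i.-1 + b i - b i.-1) * (b i.+1 - b i.-2)
  + (a i - a i.-1) * (4 * a i.+2 - a i.-1)
  - a i.+1 * (a i.+1 - a i.-2).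

Definition quadP (i : nat) (t : R) : R :=
  a i.-1 * coefA i + coefB i * t + a i.-1 * coefC i * t ^+ 2.

End OrthonormalPolynomials.

Definition largest_zero (R : realType) (p : {poly R}) (x : R) : Prop :=
  root p x /\ forall y : R, root p y -> y <= x.

Lemma largest_zero_unique (R : realType) (p : {poly R}) (x y : R) :
  largest_zero p x -> largest_zero p y -> x = y.
Proof.
by move=> [rx hx] [ry hy]; apply/eqP; rewrite eq_le hx // hy.
Qed.

Lemma largest_zero_of_root (R : realType) (p : {poly R}) (z : R) :
  p != 0 -> root p z -> exists x, largest_zero p x.
Proof.
move=> p0 rz; have memE y : root p y = (y \in rootsR p).
  by have := roots_on_rootsR p0 y; rewrite in_itv.
rewrite memE in rz.
suff main (s : seq R) : z \in s -> exists2 x, x \in s & {in s, forall y, y <= x}.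
  have [x xs hx] := main _ rz.
  by exists x; split=> [|y]; rewrite memE // => /hx.
elim: s z {rz memE p0} => // u s IH _ _; case: s IH => [|v s] IH.
  by exists u => [|y]; rewrite inE // => /eqP ->.
have [x xs hx] := IH v (mem_head _ _).
have [ux|xu] := leP u x.
  exists x; first by rewrite inE xs orbT.
  by move=> y; rewrite inE => /orP[/eqP ->|/hx].
exists u; first exact: mem_head.
move=> y.
by rewrite inE => /orP[/eqP -> //|/hx yx]; exact: le_trans yx (ltW xu).
Qed.

Lemma size_lead_opoly (R : realType) (a b : nat -> R) (k : nat) :
  (forall m, (1 <= m)%N -> 0 < a m) ->
  size (opoly a b k) = k.+1 /\ 0 < lead_coef (opoly a b k).
Proof.
move=> a_gt0.
suff: (size (shifted_opoly a b k) <= k)%N /\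
      (size (opoly a b k) = k.+1 /\ 0 < lead_coef (opoly a b k)) by case.
elim: k => [|k [IHs [IHz IHl]]].
  by rewrite /opoly /= size_poly0 size_poly1 lead_coef1 ltr01; do !split.
split; first by rewrite -[X in (_ <= X)%N]IHz.
have ak : 0 < (a k.+1)^-1 by rewrite invr_gt0 a_gt0.
have opolyS : opoly a b k.+1 =
    (a k.+1)^-1 *: (('X - (b k)%:P) * opoly a b k - a k *: shifted_opoly a b k) by [].
have p0 : opoly a b k != 0 by rewrite -size_poly_gt0 IHz.
set q := ('X - (b k)%:P) * opoly a b k in opolyS *.
have sM : size q = k.+2 by rewrite size_mul ?polyXsubC_eq0 // size_XsubC IHz.
have lt : (size (- (a k *: shifted_opoly a b k))%R < size q)%N.
  by rewrite size_polyN sM ltnS (leq_trans (size_scale_leq _ _)) // leqW.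
rewrite opolyS size_scale ?gt_eqF // size_polyDl // sM; split=> //.
by rewrite lead_coefZ lead_coefDl // lead_coefM lead_coefXsubC mul1r mulr_gt0.
Qed.

Lemma largest_zero_opoly (R : realType) (a b : nat -> R) (k : nat) :
  (forall m, (1 <= m)%N -> 0 < a m) -> a 0%N = 0 -> (1 <= k)%N ->
  exists x, largest_zero (opoly a b k) x.
Proof.
move=> a_gt0 a0; case: k => // k _.
suff [x xP _] : exists2 x, largest_zero (opoly a b k.+1) x &
   forall y, x <= y -> 0 < (opoly a b k).[y] by exists x.
have nz m : opoly a b m != 0.
  by have [sz _] := size_lead_opoly b m a_gt0; rewrite -size_poly_gt0 sz.
have pos m x : (forall y, x <= y -> ~~ root (opoly a b m) y) ->
    forall y, x <= y -> 0 < (opoly a b m).[y].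
  move=> nr y xy; rewrite -sgr_gt0.
  rewrite (@sgp_pinftyP _ x (opoly a b m)) ?in_itv ?andbT //.
    by rewrite /sgp_pinfty sgr_gt0; have [] := size_lead_opoly b m a_gt0.
  by move=> z; rewrite in_itv /= andbT => /nr.
elim: k => [|k [x [rx hx] px]].
  have opoly0 : opoly a b 0 = 1 by [].
  have [|x xP] := @largest_zero_of_root _ (opoly a b 1) (b 0%N) (nz _).
    by rewrite /root /opoly /= a0 scale0r subr0 mulr1 !hornerE subrr mulr0.
  by exists x => // y _; rewrite opoly0 hornerC.
have neg : (opoly a b k.+2).[x] < 0.
  have -> : opoly a b k.+2 = (a k.+2)^-1 *:
      (('X - (b k.+1)%:P) * opoly a b k.+1 - a k.+1 *: opoly a b k) by [].
  rewrite hornerZ hornerD hornerN hornerM.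
  rewrite (eqP rx) mulr0 sub0r pmulr_rlt0 ?invr_gt0 ?a_gt0 // hornerZ.
  by rewrite oppr_lt0 mulr_gt0 ?a_gt0 ?px.
have [z xz rz] : exists2 z, x <= z & root (opoly a b k.+2) z.
  apply: contrapT => nz_root.
  have /pos/(_ x (lexx x)) : forall y, x <= y -> ~~ root (opoly a b k.+2) y.
    by move=> y xy; apply/negP => ry; apply: nz_root; exists y.
  by rewrite ltNge ltW.
have [w [rw hw]] := largest_zero_of_root (nz k.+2) rz.
exists w => // y wy; apply: (pos k.+1 _ _ y (lexx y)) => u yu.
apply/negP => /hx ux.
have wx : w = x.
  by apply: le_anti; rewrite (le_trans wy (le_trans yu ux)) (le_trans xz (hw _ rz)).
by move: neg; rewrite -wx (eqP rw) ltxx.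
Qed.

(* Main.v *)
Require Import Defs.
From mathcomp Require Import polyrcf ring lra.
Import Order.TTheory GRing.Theory Num.Theory.
Local Open Scope ring_scope.

(** Write [p_i] for the value of the [i]-th polynomial at a point [x].
    The idea is to pass from [T4(p_(i-1)) >= 0] to
    [T4(p_i) >= 0] at a fixed [x], for [i = j+1, ..., k].

    Eliminating [x] between two consecutive recurrences gives an expression
    for [a_(i+1) p_(i-1) p_(i+1)] as a quadratic form in [p_(i-2), p_(i-1), p_i]
    ([opoly_cross]).  The same elimination between the recurrences for [p_(i+2)]
    and [p_(i-3)] turns [a_(i+2) T4(p_i) - a_(i-2) T4(p_(i-1))] into a combination
    of products of the four values [p_(i-2), ..., p_(i+1)].  Two of those
    products have to be estimated:
    - [p_(i-2) p_i], which has a nonpositive coefficient, is at most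
      [p_(i-1)^2]: this is the Turan inequality ([opoly_turan]), which the
      monotonicity of the coefficients propagates from one index to the next
      as long as the values are nonnegative;
    - [p_(i-2) p_(i+1)], whose coefficient [-(b_(i+1) - b_(i-2))] is nonpositive
      too, is bounded by a combination of [p_(i-1) p_i] and [p_(i-1)^2]
      ([opoly_skip_le]); this is where [x >= b_i + a_i] is needed.
    What remains, after multiplication by [a_(i-1) a_(i+1)], is [p_i^2] times the quadratic [quadP i] evaluated at
    [p_(i-1) / p_i], hence nonnegative ([T4_step]).

    The values at [x] are positive because the largest zeros increase with the
    degree ([opoly_gt0_ge_largest_zero]), so that a point beyond the largest
    zero of [p_k] lies beyond the zeros of all the earlier polynomials. *)

(** * Positivity beyond the largest zero *)

Section Positivity.
Set Implicit Arguments.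
Unset Strict Implicit.

Context (R : realType) (a b : nat -> R).
Hypothesis a_gt0 : forall i : nat, (1 <= i)%N -> 0 < a i.

Lemma shifted_opoly_horner (x : R) (n : nat) :
  a n.+1 * (shifted_opoly a b n.+2).[x] =
  (x - b n) * (shifted_opoly a b n.+1).[x] - a n * (shifted_opoly a b n).[x].
Proof.
rewrite [shifted_opoly a b n.+2]/= hornerZ mulrA divff ?gt_eqF ?a_gt0 // mul1r.
by rewrite !hornerE.
Qed.

(** The leading coefficient is positive and there is no sign change beyond the
    largest zero. *)
Lemma opoly_gt0_gt_largest_zero (n : nat) (z y : R) :
  largest_zero (opoly a b n) z -> z < y -> 0 < (opoly a b n).[y].
Proof.
move=> [_ zP] zy; rewrite -sgr_gt0 (@sgp_pinftyP _ y) ?in_itv /= ?lexx //.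
  by rewrite /sgp_pinfty sgr_gt0; have [] := size_lead_opoly b n a_gt0.
move=> u; rewrite in_itv /= andbT => yu; apply/negP => /zP.
by rewrite leNgt (lt_le_trans zy yu).
Qed.

(** At the largest zero [w] of [p_(n+1)] the recurrence gives
    [p_(n+2)(w) = - (a_(n+1) / a_(n+2)) p_n(w) < 0], and [p_(n+2)] cannot be
    negative from its own largest zero on; so the latter is larger than [w]. *)
Lemma opoly_gt0_ge_largest_zero (n : nat) (z y : R) : a 0%N = 0 ->
  largest_zero (opoly a b n.+1) z -> z <= y -> 0 < (opoly a b n).[y].
Proof.
move=> a0; elim: n z y => [|n IH] z y zP zy; first by rewrite hornerC.
have [w wP] := largest_zero_opoly b a_gt0 a0 (ltn0Sn n).
have [/rootP pw _] := wP.
have neg : (opoly a b n.+2).[w] < 0.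
  have := shifted_opoly_horner w n.+1.
  rewrite -/(opoly a b n.+2) -/(opoly a b n.+1) -/(opoly a b n) pw mulr0 sub0r.
  move=> e; rewrite -(pmulr_rlt0 _ (a_gt0 (ltn0Sn n.+1))) e oppr_lt0.
  by rewrite mulr_gt0 ?a_gt0 ?(IH w).
have wz : w < z.
  rewrite ltNge le_eqVlt; apply/negP => /orP[/eqP zw|zw].
    by have [/rootP pz _] := zP; rewrite -zw pz ltxx in neg.
  by have := lt_trans neg (opoly_gt0_gt_largest_zero zP zw); rewrite ltxx.
exact: opoly_gt0_gt_largest_zero wP (lt_le_trans wz zy).
Qed.

Lemma opoly_gt0 (k m : nat) (z y : R) : a 0%N = 0 ->
  largest_zero (opoly a b k) z -> (m <= k)%N -> z < y -> 0 < (opoly a b m).[y].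
Proof.
move=> a0 zP mk zy; elim: k z zP mk zy => [|k IH] z zP.
  by rewrite leqn0 => /eqP -> zy; apply: opoly_gt0_gt_largest_zero zP zy.
rewrite leq_eqVlt => /orP[/eqP -> zy|].
  exact: opoly_gt0_gt_largest_zero zP zy.
rewrite ltnS => mk zy.
have pk_gt0 u : y <= u -> 0 < (opoly a b k).[u].
  by move=> yu; apply: opoly_gt0_ge_largest_zero zP (le_trans (ltW zy) yu).
case: k => [|k] in IH zP mk pk_gt0 *.
  by move: mk; rewrite leqn0 => /eqP ->; exact: pk_gt0.
have [w wP] := largest_zero_opoly b a_gt0 a0 (ltn0Sn k).
apply: (IH w) => //; rewrite ltNge; apply/negP => /pk_gt0.
by have [/rootP -> _] := wP; rewrite ltxx.
Qed.

End Positivity.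

(** * Quadratic relations between consecutive values *)

Section Values.
Set Implicit Arguments.
Unset Strict Implicit.

Context (R : realType) (a b : nat -> R) (x : R).
Hypothesis a0 : a 0%N = 0.
Hypothesis a_gt0 : forall i : nat, (1 <= i)%N -> 0 < a i.
Hypothesis a_nondecreasing : {homo a : m n / (m <= n)%N >-> m <= n}.
Hypothesis b_nondecreasing : {homo b : m n / (m <= n)%N >-> m <= n}.

Local Notation p n := (shifted_opoly a b n).[x].

(** Multiplying the recurrence for [p n.+3] by [p n.+1], the one for [p n.+2]
    by [p n.+2], and subtracting removes [x]. *)
Lemma opoly_cross (n : nat) :
  a n.+2 * (p n.+1 * p n.+3) =
  a n.+1 * p n.+2 ^+ 2 + a n * (p n * p n.+2) - a n.+1 * p n.+1 ^+ 2
  - (b n.+1 - b n) * (p n.+1 * p n.+2).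
Proof.
have e1 := shifted_opoly_horner b a_gt0 x n.
have e2 := shifted_opoly_horner b a_gt0 x n.+1.
transitivity (p n.+1 * (a n.+2 * p n.+3)); first by ring.
rewrite e2.
transitivity (p n.+2 * (a n.+1 * p n.+2 + a n * p n) - a n.+1 * p n.+1 ^+ 2
  - (b n.+1 - b n) * (p n.+1 * p n.+2)); last by ring.
by rewrite e1; ring.
Qed.

(** By [opoly_cross], [a n.+2] times the Turan determinant
    [(p n.+2)^2 - p n.+1 p n.+3] is [a n] times the previous determinant plus
    terms whose coefficients are increments of [a] and [b].  The values must be
    nonnegative only because one of these terms is the product of two of them. *)
Lemma opoly_turan (n : nat) : (forall m, (m <= n)%N -> 0 <= p m.+1) ->
  p n * p n.+2 <= p n.+1 ^+ 2.
Proof.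
elim: n => [|n IH] p_ge0; first by rewrite hornerC mul0r sqr_ge0.
have {}IH := IH (fun m mn => p_ge0 m (leqW mn)).
have cross := opoly_cross n.
have a2 := a_gt0 (ltn0Sn n.+1).
have a01 : 0 <= a n.+1 - a n by rewrite subr_ge0 a_nondecreasing.
have a12 : 0 <= a n.+2 - a n.+1 by rewrite subr_ge0 a_nondecreasing.
have b01 : 0 <= b n.+1 - b n by rewrite subr_ge0 b_nondecreasing.
have a_ge0 : 0 <= a n by rewrite -a0 a_nondecreasing.
rewrite -(ler_pM2l a2) cross -subr_ge0.
have -> : a n.+2 * p n.+2 ^+ 2 - (a n.+1 * p n.+2 ^+ 2 + a n * (p n * p n.+2)
    - a n.+1 * p n.+1 ^+ 2 - (b n.+1 - b n) * (p n.+1 * p n.+2)) =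
  (a n.+2 - a n.+1) * p n.+2 ^+ 2 + a n * (p n.+1 ^+ 2 - p n * p n.+2)
  + (a n.+1 - a n) * p n.+1 ^+ 2 + (b n.+1 - b n) * (p n.+1 * p n.+2) by ring.
rewrite -subr_ge0 in IH.
by rewrite !addr_ge0 // mulr_ge0 ?sqr_ge0 // mulr_ge0 ?p_ge0.
Qed.

(** The recurrences for [p n.+3] and [p n.+4] express the difference of the two
    sides as
    [(a n.+2 - a n.+1) (x - b n.+1 - a n.+1) (p n.+2)^2
     + (x - b n.+2) a n.+1 ((p n.+2)^2 - p n.+1 p n.+3)],
    in which all factors are nonnegative, the last one by the Turan inequality. *)
Lemma opoly_skip_le (n : nat) : b n.+2 + a n.+2 <= x ->
  p n.+1 * p n.+3 <= p n.+2 ^+ 2 ->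
  a n.+1 * (a n.+3 * (p n.+1 * p n.+4)) <=
  a n.+2 ^+ 2 * (p n.+2 * p n.+3)
  - a n.+1 * (a n.+2 - a n.+1 + b n.+2 - b n.+1) * p n.+2 ^+ 2.
Proof.
move=> xge turan.
have e1 := shifted_opoly_horner b a_gt0 x n.+1.
have e2 := shifted_opoly_horner b a_gt0 x n.+2.
have a1 := a_gt0 (ltn0Sn n).
have a12 : a n.+1 <= a n.+2 by exact: a_nondecreasing.
have b12 : b n.+1 <= b n.+2 by exact: b_nondecreasing.
rewrite -subr_ge0.
have -> : a n.+2 ^+ 2 * (p n.+2 * p n.+3)
    - a n.+1 * (a n.+2 - a n.+1 + b n.+2 - b n.+1) * p n.+2 ^+ 2
    - a n.+1 * (a n.+3 * (p n.+1 * p n.+4)) =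
  (a n.+2 - a n.+1) * (x - b n.+1 - a n.+1) * p n.+2 ^+ 2
  + (x - b n.+2) * a n.+1 * (p n.+2 ^+ 2 - p n.+1 * p n.+3).
  have -> : a n.+1 * (a n.+3 * (p n.+1 * p n.+4)) =
    a n.+1 * p n.+1 * (a n.+3 * p n.+4) by ring.
  have e1' : a n.+1 * p n.+1 = (x - b n.+1) * p n.+2 - a n.+2 * p n.+3.
    by rewrite e1; ring.
  have -> : (x - b n.+2) * a n.+1 * (p n.+2 ^+ 2 - p n.+1 * p n.+3) =
    (x - b n.+2) * (a n.+1 * p n.+2 ^+ 2 - a n.+1 * p n.+1 * p n.+3) by ring.
  by rewrite e2 e1'; ring.
apply: addr_ge0; apply: mulr_ge0; rewrite ?sqr_ge0 ?subr_ge0 //.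
  by apply: mulr_ge0; lra.
by apply: mulr_ge0; lra.
Qed.

(** * Propagation of the inequality from one index to the next *)

Lemma T4_horner (n : nat) : (T4 a b n.+1).[x] =
  3 * p n.+2 ^+ 2 - 4 * (p n.+1 * p n.+3) + p n * p n.+4.
Proof. by rewrite /T4 !(hornerD, hornerN, hornerZ, hornerM, horner_exp). Qed.

(** The recurrence that yields [p n.+4.+1] and the one that yields [p n] by going
    backwards are both used here; their [x]-terms are equal and cancel.  Since
    [a 0 = 0], the formula stays meaningful for [n = 0], where no backward
    recurrence could define the missing polynomial. *)
Lemma opoly_outer_diff (n : nat) :
  a n.+4 * (p n.+1 * p n.+4.+1) - a n * (p n * p n.+4) =
  a n.+1 * (p n.+2 * p n.+4) - a n.+3 * (p n.+1 * p n.+3)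
  - (b n.+3 - b n) * (p n.+1 * p n.+4).
Proof.
have e1 := shifted_opoly_horner b a_gt0 x n.
have e2 := shifted_opoly_horner b a_gt0 x n.+3.
have e1' : a n * p n = (x - b n) * p n.+1 - a n.+1 * p n.+2 by rewrite e1; ring.
transitivity (p n.+1 * (a n.+4 * p n.+4.+1) - a n * p n * p n.+4); first by ring.
by rewrite e2 e1'; ring.
Qed.

(** The difference [a n.+4 T4(n.+2) - a n T4(n.+1)], multiplied by
    [a n.+1 a n.+3], is the sum of the homogenized quadratic [quad], of a
    nonnegative multiple of the Turan determinant, and of [b n.+3 - b n] times
    the gap in [opoly_skip_le].  The factor [a n] on the lower index makes [x]
    cancel, and it may be zero. *)
Lemma T4_step (n : nat) : b n.+2 + a n.+2 <= x ->
  (forall m, (m <= n.+2)%N -> 0 < p m.+1) ->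
  (forall t, 0 <= t -> 0 <= quadP a b n.+2 t) ->
  0 <= (T4 a b n.+1).[x] -> 0 <= (T4 a b n.+2).[x].
Proof.
move=> xge p_gt0 quad_ge0 T_ge0.
have turan : p n.+1 * p n.+3 <= p n.+2 ^+ 2.
  by apply: opoly_turan => m mn; rewrite ltW ?p_gt0 // ltnW.
have skip := opoly_skip_le xge turan.
have cross := opoly_cross n.+1.
have outer := opoly_outer_diff n.
have q3 := p_gt0 n.+2 (leqnn _).
have q2 := p_gt0 n.+1 (leqnSn _).
have [[a1 a3] a4] := (a_gt0 (ltn0Sn n), a_gt0 (ltn0Sn n.+2), a_gt0 (ltn0Sn n.+3)).
have a_ge0 : 0 <= a n by rewrite -a0 a_nondecreasing.
have a01 : a n <= a n.+1 by exact: a_nondecreasing.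
have a13 : a n.+1 <= a n.+3 by exact: (a_nondecreasing (leqW (leqnSn _))).
have a34 : a n.+3 <= a n.+4 by exact: a_nondecreasing.
have b03 : 0 <= b n.+3 - b n.
  by rewrite subr_ge0 b_nondecreasing // -[X in (_ <= X)%N]addn3 leq_addr.
(* [quadP] at [p n.+2 / p n.+3], cleared of its denominator *)
have quad : 0 <= a n.+1 * coefA a n.+2 * p n.+3 ^+ 2
    + coefB a b n.+2 * (p n.+2 * p n.+3)
    + a n.+1 * coefC a b n.+2 * p n.+2 ^+ 2.
  have := quad_ge0 (p n.+2 / p n.+3) (divr_ge0 (ltW q2) (ltW q3)).
  rewrite -(pmulr_rge0 _ (exprn_gt0 2 q3)).
  congr (0 <= _); rewrite /quadP /=.
  by field; rewrite gt_eqF.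
(* this is minus the coefficient of [p n.+1 * p n.+3] in
   [a n.+3 (a n.+4 T4(n.+2) - a n T4(n.+1))], after using [outer] and [cross] *)
have K_ge0 :
    0 <= (4 * a n.+4 - a n.+1) * a n.+1 - 4 * a n * a n.+3 + a n.+3 ^+ 2.
  have : 0 <= 4 * a n.+1 * (a n.+4 - a n.+3)
    by rewrite mulr_ge0 ?subr_ge0 // mulr_ge0 ?ler0n ?ltW.
  have : 0 <= 4 * a n.+3 * (a n.+1 - a n)
    by rewrite mulr_ge0 ?subr_ge0 // mulr_ge0 ?ler0n ?ltW.
  have : 0 <= (a n.+3 - a n.+1) * (a n.+3 + a n.+1).
    by rewrite mulr_ge0 ?subr_ge0 // addr_ge0 ?ltW.
  lra.
rewrite -(pmulr_rge0 _ a4) -(pmulr_rge0 _ a3) -(pmulr_rge0 _ a1).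
have T_ge0' := mulr_ge0 (ltW a1) (mulr_ge0 (ltW a3) (mulr_ge0 a_ge0 T_ge0)).
rewrite -(subrK (a n.+1 * (a n.+3 * (a n * (T4 a b n.+1).[x]))) (_ * _)).
apply: addr_ge0 => //.
have turan' : 0 <= ((4 * a n.+4 - a n.+1) * a n.+1 - 4 * a n * a n.+3
    + a n.+3 ^+ 2) * a n.+1 * (p n.+2 ^+ 2 - p n.+1 * p n.+3).
  by apply: mulr_ge0; [apply: mulr_ge0 K_ge0 (ltW a1) | rewrite subr_ge0].
rewrite -subr_ge0 in skip; have skip' := mulr_ge0 b03 skip.
rewrite (le_trans (addr_ge0 (addr_ge0 quad turan') skip')) //.
rewrite le_eqVlt; apply/orP; left; apply/eqP.
(* group the products so that [outer] and then [cross] apply verbatim *)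
transitivity (a n.+1 * (
  3 * a n.+3 * (a n.+4 * p n.+3 ^+ 2 - a n * p n.+2 ^+ 2)
  - 4 * (a n.+4 * (a n.+3 * (p n.+2 * p n.+4)) - a n.+3 * a n * (p n.+1 * p n.+3))
  + a n.+3 * (a n.+4 * (p n.+1 * p n.+4.+1) - a n * (p n * p n.+4)))); last first.
  by rewrite !T4_horner; ring.
rewrite outer.
transitivity (a n.+1 * (
  3 * a n.+3 * (a n.+4 * p n.+3 ^+ 2 - a n * p n.+2 ^+ 2)
  + 4 * a n.+3 * a n * (p n.+1 * p n.+3)
  - (4 * a n.+4 - a n.+1) * (a n.+3 * (p n.+2 * p n.+4))
  - a n.+3 ^+ 2 * (p n.+1 * p n.+3)
  - a n.+3 * (b n.+3 - b n) * (p n.+1 * p n.+4))); last by ring.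
by rewrite cross /coefA /coefB /coefC /=; ring.
Qed.

End Values.

Theorem theorem10 (R : realType) (a b : nat -> R)
  (a0 : a 0%N = 0)
  (a_gt0 : forall i : nat, (1 <= i)%N -> 0 < a i)
  (a_nondecreasing : {homo a : m n / (m <= n)%N >-> m <= n})
  (b_nondecreasing : {homo b : m n / (m <= n)%N >-> m <= n})
  (j k : nat) (j_ge1 : (1 <= j)%N) (j_lt_k : (j < k)%N)
  (xj1 xk : R)
  (xj1_largest : largest_zero (opoly a b j.+1) xj1)
  (xk_largest : largest_zero (opoly a b k) xk)
  (T4j_ge0 : forall x : R,
     Num.max xj1 (b j.+1 + a j.+1) <= x -> 0 <= (T4 a b j).[x])
  (quadP_ge0 : forall i : nat, (j.+1 <= i <= k)%N ->
     forall t : R, 0 <= t -> 0 <= quadP a b i t)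
  (a_ge_db : forall i : nat, (j <= i <= k.-1)%N -> b i.+1 - b i <= a i) :
  forall x : R, Num.max xk (b k + a k) < x -> 0 <= (T4 a b k).[x].
Proof.
move=> x; rewrite gt_max => /andP[xk_lt /ltW ba_le].
have p_gt0 m : (m <= k)%N -> 0 < (opoly a b m).[x].
  by move=> mk; apply: opoly_gt0 xk_largest mk xk_lt.
have ba_le_x i : (i <= k)%N -> b i + a i <= x.
  by move=> ik; rewrite (le_trans _ ba_le) // lerD ?b_nondecreasing ?a_nondecreasing.
suff T4_ge0 i : (j <= i)%N -> (i <= k)%N -> 0 <= (T4 a b i).[x].
  exact: T4_ge0 (ltnW j_lt_k) (leqnn k).
elim: i => [|i IH]; first by rewrite leqNgt j_ge1.
rewrite leq_eqVlt => /orP[/eqP <- _|].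
  apply: T4j_ge0; rewrite ge_max ba_le_x // andbT.
  (* otherwise [p_(j+1)] would be positive at its own zero [xj1] *)
  rewrite leNgt; apply/negP => x_lt.
  have := opoly_gt0 a_gt0 a0 xk_largest j_lt_k (lt_trans xk_lt x_lt).
  by have [/rootP -> _] := xj1_largest; rewrite ltxx.
rewrite ltnS => ji ik; have {}IH := IH ji (ltnW ik).
case: i => [|i] in ji ik IH *; first by rewrite leqNgt j_ge1 in ji.
apply: T4_step IH => //; first exact: ba_le_x.
  by move=> m mi; apply: p_gt0 (leq_trans mi ik).
by apply: quadP_ge0; rewrite ltnS ji ik.
Qed.
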